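(* Let $f:X\to Y$ be a continuous map between zero-dimensional locally compact Hausdorff spaces, let $(A,I)=(CO(X),CK(X))$, $(B,J)=(CO(Y),CK(Y))$, and let $\varphi=\Theta^t(f):B\to A$ be given by $\varphi(G)=f^{-1}(G)$. Then $f$ is an injection iff $\varphi$ satisfies the following condition: (InZLC) for any $a,b\in I$ such that $a\wedge b=0$ there exist $a',b'\in J$ with $a'\wedge b'=0$, $\varphi(a')\ge a$ and $\varphi(b')\ge b$.
   Context: A space is zero-dimensional if its clopen subsets form a base. $CO(X)$ is the Boolean algebra of clopen subsets of $X$ and $CK(X)$ is the set of compact clopen subsets of $X$. *)

(* Defs.v *)
From HB Require Import structures.
From mathcomp Require Import all_boot all_order.
From mathcomp Require Import boolp classical_sets filter topology.

Set Implicit Arguments.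
Unset Strict Implicit.
Unset Printing Implicit Defensive.

Import Order.TTheory.

Local Open Scope classical_set_scope.

(* The clopen sets form a base of the topology. The library's
   [zero_dimensional] is a different notion: it only asks that distinct points
   be separated by a clopen set. *)
Definition zero_dimensional_space (X : topologicalType) : Prop :=
  basis (@clopen X).

Definition clopen_pred (X : topologicalType) : pred (set X) :=
  fun U => `[< clopen U >].

Record CO (X : topologicalType) := ClopenSet {
  CO_val :> set X;
  CO_clopen : clopen_pred CO_val
}.

Fact CO_display : Order.disp_t. Proof. exact: (Order.Disp tt tt). Qed.

Section ClopenAlgebra.
Context {X : topologicalType}.

HB.instance Definition _ := [isSub for @CO_val X].
HB.instance Definition _ := [Choice of CO X by <:].

Fact CO_valP (U : CO X) : clopen (val U).
Proof. exact/asboolP/CO_clopen. Qed.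

Fact CO_meet_closed : meet_closed (@clopen_pred X).
Proof. by move=> U V /asboolP cU /asboolP cV; apply/asboolP/clopenI. Qed.

Fact CO_join_closed : join_closed (@clopen_pred X).
Proof. by move=> U V /asboolP cU /asboolP cV; apply/asboolP/clopenU. Qed.

Fact CO_bot : \bot%O \in @clopen_pred X.
Proof. exact/asboolP/clopen0. Qed.

Fact CO_top : \top%O \in @clopen_pred X.
Proof. exact/asboolP/clopenT. Qed.

(* The order and the lattice operations are those of [set X]: inclusion, [`&`],
   [`|`], [set0] and [setT]. *)
HB.instance Definition _ := Order.SubChoice_isTBSubLattice.Build
  set_display (set X) (@clopen_pred X) CO_display (CO X)
  CO_meet_closed CO_join_closed CO_bot CO_top.

Fact CO_meetUl : @left_distributive (CO X) (CO X) Order.meet Order.join.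
Proof. by move=> U V W; apply: val_inj; exact: setIUl. Qed.

HB.instance Definition _ :=
  Order.Lattice_Meet_isDistrLattice.Build CO_display (CO X) CO_meetUl.

Definition CO_compl (U : CO X) : CO X :=
  ClopenSet (asboolT (clopenC (val U) (CO_valP U))).

Fact CO_joinxC (U : CO X) : (U `|` CO_compl U)%O = \top%O.
Proof. by apply: val_inj; exact: setUCr. Qed.

Fact CO_meetxC (U : CO X) : (U `&` CO_compl U)%O = \bot%O.
Proof. by apply: val_inj; exact: setICr. Qed.

HB.instance Definition _ := Order.TBDistrLattice_hasComplement.Build
  CO_display (CO X) CO_joinxC CO_meetxC.

End ClopenAlgebra.

Definition CK (X : topologicalType) : set (CO X) :=
  [set U | compact (val U)].

Definition Theta (X Y : topologicalType) (f : X -> Y) (fc : continuous f)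
    (G : CO Y) : CO X :=
  ClopenSet (asboolT (preimage_clopen (CO_valP G) fc)).

Definition InZLC (dA dB : Order.disp_t)
    (A : ctbDistrLatticeType dA) (B : ctbDistrLatticeType dB)
    (I : set A) (J : set B) (phi : B -> A) : Prop :=
  forall a b : A, I a -> I b -> (a `&` b = \bot)%O ->
  exists a' b' : B,
    [/\ J a', J b', (a' `&` b' = \bot)%O, (a <= phi a')%O & (b <= phi b')%O].

(* Main.v *)
Require Import Defs.
From mathcomp Require Import all_boot all_order.
From mathcomp Require Import boolp classical_sets filter topology.

Local Open Scope classical_set_scope.

(** Both directions are separation statements about compact clopen sets. In a
    zero-dimensional locally compact space these form a base
    ([nbhs_compact_clopen]), and since they are closed under finite unions one
    of them fits between any compact set and any open set around it
    ([compact_clopen_between]). In the Hausdorff case compact sets are closed,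
    so disjoint compact sets lie in disjoint compact clopen sets
    ([compact_clopen_separate]).

    If [f] is injective and [a], [b] are disjoint compact clopen sets, then
    [f @` a] and [f @` b] are disjoint and compact, and the sets separating them
    are the required [a'] and [b'].

    Conversely, distinct points [x] and [y] of [X] lie in disjoint compact
    clopen sets [a] and [b]; the disjoint sets [a'] and [b'] provided by the
    condition contain [f x] and [f y] respectively, so [f x] and [f y]
    differ. *)

(** Compactness in the form of an induction principle. Ordered by
    inclusion, [E] is directed, and for large [V] in [E] points near a given
    point of [K] lie in [V]; compactness makes this uniform over [K]. *)
Lemma compact_sub_setU_closed {T : topologicalType} (E : set (set T))
    (K : set T) :
  compact K -> E set0 -> setU_closed E ->
  (forall x, K x -> exists2 V, E V & nbhs x V) ->
  exists2 V, E V & K `<=` V.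
Proof.
move=> /compact_near_coveringP cK E0 EU Eloc.
pose F := filter_from E (fun V => [set W | E W /\ V `<=` W]).
have FF : Filter F.
  apply: filter_from_filter; first by exists set0.
  move=> V W EV EW; exists (V `|` W); first exact: EU.
  move=> Z [EZ VWZ]; split; split=> // z ?; apply: VWZ; [by left|by right].
have [|V EV VK] := cK _ F (fun W x => W x) FF.
  move=> x /Eloc[V EV Vx]; exists (V, [set W | E W /\ V `<=` W]) => /=.
    by split=> //; exists V.
  by move=> [y W] [/= Vy [_]]; exact.
by exists V => //; exact: (VK V (conj EV (fun _ => id))).
Qed.

Lemma CO_meet_eq0 {T : topologicalType} (C D : CO T) :
  (C `&` D = \bot)%O <-> (C : set T) `&` D = set0.
Proof. by split=> [/(congr1 val)//|CD0]; apply: val_inj. Qed.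

Lemma CO_leE {T : topologicalType} (C D : CO T) :
  (C <= D)%O <-> (C : set T) `<=` D.
Proof. by rewrite -Order.le_val subsetEset. Qed.

Section ZeroDimensionalLocallyCompact.
Context {T : topologicalType}.
Hypotheses (lT : locally_compact [set: T]) (zT : zero_dimensional_space T).

(** The compact clopen sets form a base, because a clopen subset of a compact
    neighbourhood is itself compact. *)
Lemma nbhs_compact_clopen (x : T) (U : set T) : nbhs x U ->
  exists2 C : set T, clopen C /\ compact C & C x /\ C `<=` U.
Proof.
move=> Ux; have [K Kx [cK _]] := lT x I.
have : nbhs x (U `&` K).
  by apply: filterI => //; move: Kx; rewrite withinET.
move=> /(zT.2 x)[C /= [cC Cx] CUK]; exists C; split=> //.
  by apply: subclosed_compact cC.2 cK _ => y /CUK[].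
by move=> y /CUK[].
Qed.

(** The compact clopen subsets of [U] contain the empty set, are closed under
    binary unions and include a neighbourhood of every point of [K]. *)
Lemma compact_clopen_between (K U : set T) :
  compact K -> open U -> K `<=` U ->
  exists2 C : set T, clopen C /\ compact C & K `<=` C /\ C `<=` U.
Proof.
move=> cK oU KU.
pose E := [set C : set T | (clopen C /\ compact C) /\ C `<=` U].
have [|||C [cC CU] KC] := @compact_sub_setU_closed T E K cK.
- by split; [split; [exact: clopen0|exact: compact0]|].
- move=> C D [[clC cC] CU] [[clD cD] DU]; split; last by rewrite subUset.
  by split; [exact: clopenU|exact: compactU].
- move=> x /KU Ux.
  have [C [clC cC] [Cx CU]] :=
    nbhs_compact_clopen _ _ (open_nbhs_nbhs (conj oU Ux)).
  by exists C => //; apply: open_nbhs_nbhs; split=> //; exact: clC.1.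
- by exists C.
Qed.

Hypothesis hT : hausdorff_space T.

(** [D] is taken outside [C], which is possible because [C] is closed. Both
    directions of the theorem rest on this: it is applied to the images of two
    compact clopen sets in the codomain, and to two points in the domain. *)
Lemma compact_clopen_separate (K L : set T) :
  compact K -> compact L -> K `&` L = set0 ->
  exists C D : CO T, [/\ CK C, CK D, (C `&` D = \bot)%O, K `<=` C & L `<=` D].
Proof.
move=> cK cL KL0.
have oLC : open (~` L) by apply: closed_openC; exact: compact_closed.
have [C [clC cC] [KC CL]] :=
  compact_clopen_between _ _ cK oLC ((disjoints_subset _ _).1 KL0).
have oCC : open (~` C) by apply: closed_openC; exact: clC.2.
have [D [clD cD] [LD DC]] : exists2 D : set T,
    clopen D /\ compact D & L `<=` D /\ D `<=` ~` C.
  by apply: compact_clopen_between => // x Lx /CL.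
exists (ClopenSet (asboolT clC)), (ClopenSet (asboolT clD)); split=> //.
by apply/CO_meet_eq0; rewrite -subset0 => x [Cx /DC].
Qed.

End ZeroDimensionalLocallyCompact.

Theorem theorem3p5 (X Y : topologicalType)
  (hX : hausdorff_space X) (lX : locally_compact [set: X])
  (zX : zero_dimensional_space X)
  (hY : hausdorff_space Y) (lY : locally_compact [set: Y])
  (zY : zero_dimensional_space Y)
  (f : X -> Y) (fc : continuous f) :
  injective f <-> InZLC (@CK X) (@CK Y) (Theta fc).
Proof.
split=> [f_inj a b ca cb /CO_meet_eq0 ab0|sep x y fxy].
  have cf (K : set X) : compact K -> compact (f @` K).
    by apply: continuous_compact; exact: continuous_subspaceT.
  have [|a' [b' [ca' cb' ab'0 faa' fbb']]] :=
      compact_clopen_separate lY zY hY _ _ (cf _ ca) (cf _ cb).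
    (* Injectivity keeps the compact images of [a] and [b] disjoint. *)
    rewrite -subset0 => _ [[x ax <-] [y bY /f_inj yx]].
    suff : ((a : set X) `&` b) x by rewrite ab0.
    by split=> //; rewrite -yx.
  exists a', b'; split=> //; apply/CO_leE => x ?.
    by apply: faa'; exists x.
  by apply: fbb'; exists x.
apply: contrapT => xy.
have [|a [b [ca cb ab0 ax bY]]] := compact_clopen_separate lX zX hX _ _
    (@compact_set1 X x) (@compact_set1 X y).
  by rewrite -subset0 => _ [-> /xy].
have [a' [b' [_ _ /CO_meet_eq0 ab'0 /CO_leE aa' /CO_leE bb']]] :=
  sep a b ca cb ab0.
have : ((a' : set Y) `&` b') (f x).
  by split; [exact/aa'/ax|rewrite fxy; exact/bb'/bY].
by rewrite ab'0.
Qed.
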